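(* Let $n \ge 2$ and let $\mathcal{C}_1 = \mathcal{C}(I^1_1, g^1), \ldots, \mathcal{C}_n = \mathcal{C}(I^n_1, g^n)$ be Cantor sets and $x_1, \ldots, x_n \ge 0$ real numbers such that $\mathrm{dr}_{\mathcal{C}_i} \ge x_i$ for $1 \le i \le n$, $$\sum_{i=1}^n \frac{x_i}{x_i + 1} \ge 1,$$ and for all $j,k \in \{1,\ldots,n\}$, $$|I^j_1| \ge \frac{x_j}{x_j + 1}(x_k + 1)\,|I^k_1|.$$ Then $\mathcal{C}_1 + \mathcal{C}_2 + \cdots + \mathcal{C}_n = I^1_1 + I^2_1 + \cdots + I^n_1$.
   Context: For an interval $I$ with endpoints $a<b$ write $|I| = b-a$. A Cantor set $\mathcal{C} = \mathcal{C}(I_1, g)$ is given by a closed interval $I_1$ of positive length and a gap function $g$: recursively, for every interval $I_i$ already constructed, $g(I_i)$ is an open interval contained in $I_i$ with $I_i = I_{2i} \cup g(I_i) \cup I_{2i+1}$ disjointly, where $I_{2i}$ and $I_{2i+1}$ are closed intervals of positive length to the left and right of $g(I_i)$. The Cantor set is $\mathcal{C} = I_1 \setminus \bigcup_{i \ge 1} g(I_i)$. The density ratio is $\mathrm{dr}_{\mathcal{C}} = \inf_{i} \frac{\min(|I_{2i}|, |I_{2i+1}|)}{|g(I_i)|}$. Sums of sets are pointwise: $A + B = \{a+b : a \in A, b \in B\}$; for closed intervals $[a_l,a_r]+[b_l,b_r] = [a_l+b_l, a_r+b_r]$. *)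

(* Defs.v *)
From HB Require Import structures.
From Corelib Require Import BinNums.
From mathcomp Require Import all_boot all_order all_algebra.
From mathcomp Require Import all_classical all_reals.

Set Implicit Arguments.
Unset Strict Implicit.
Unset Printing Implicit Defensive.

Import Order.TTheory GRing.Theory Num.Theory.

Local Open Scope classical_set_scope.
Local Open Scope ring_scope.

(* Intervals are given by their pair of endpoints; a pair stands for a closed *)
(* interval in some places ([citv]) and for an open one in others ([oitv]).   *)
Definition citv (R : realType) (I : R * R) : set R := `[I.1, I.2].
Definition oitv (R : realType) (I : R * R) : set R := `]I.1, I.2[.
Definition ilen (R : realType) (I : R * R) : R := I.2 - I.1.

(* The intervals I_i of the construction, for a gap function g taking a       *)
(* closed interval [a, b] to an open one ]c, d[: the left child is [a, c] and *)
(* the right child is [d, b]. The constructors of [positive] are the indexing *)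
(* of the tree: xH = 1, xO i = 2i, xI i = 2i + 1.                             *)
Fixpoint bridge (R : realType) (I1 : R * R) (g : R * R -> R * R)
    (i : positive) : R * R :=
  match i with
  | xH => I1
  | xO j => let I := bridge I1 g j in (I.1, (g I).1)
  | xI j => let I := bridge I1 g j in ((g I).2, I.2)
  end.

(* [gap_in] says that both children of every I_i have positive length and     *)
(* that g(I_i) is nonempty; the latter is forced by I_i being the disjoint    *)
(* union of g(I_i) and the two closed children. The values of g on intervals  *)
(* which do not occur in the construction are irrelevant.                     *)
Record cantor_system (R : realType) := CantorSystem {
  hull : R * R;
  gap : R * R -> R * R;
  hull_lt : hull.1 < hull.2;
  gap_in : forall i : positive,
    let I := bridge hull gap i in
    [/\ I.1 < (gap I).1, (gap I).1 < (gap I).2 & (gap I).2 < I.2]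
}.

Definition cbridge (R : realType) (C : cantor_system R) (i : positive) : R * R :=
  bridge (hull C) (gap C) i.

Definition cantor_set (R : realType) (C : cantor_system R) : set R :=
  citv (hull C) `\` \bigcup_(i in [set: positive]) oitv (gap C (cbridge C i)).

(* The infimum is taken in R: the set is nonempty and bounded below by 0.     *)
Definition density_ratio (R : realType) (C : cantor_system R) : R :=
  inf (range (fun i : positive =>
    Num.min (ilen (cbridge C (xO i))) (ilen (cbridge C (xI i)))
      / ilen (gap C (cbridge C i)))).

Definition sumset (R : realType) (A B : set R) : set R :=
  [set a + b | a in A & b in B].

Section SumsetMonoid.
Variable R : realType.

Fact sumsetA : associative (@sumset R).
Proof.
move=> A B C; apply/seteqP; split=> z.
- case=> a Aa [_ [b Bb [c Cc <-]]] <-.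
  by exists (a + b); [exists a => //; exists b | exists c => //; rewrite addrA].
- case=> _ [a Aa [b Bb <-]] [c Cc <-].
  by exists a => //; exists (b + c); [exists b => //; exists c | rewrite addrA].
Qed.

Fact sumsetC : commutative (@sumset R).
Proof.
move=> A B; apply/seteqP; split=> z [a Aa [b Bb <-]];
  by exists b => //; exists a => //; rewrite addrC.
Qed.

Fact sum0set : left_id [set 0] (@sumset R).
Proof.
move=> A; apply/seteqP; split=> z.
- by case=> _ -> [a Aa <-]; rewrite add0r.
- by move=> Az; exists 0 => //; exists z => //; rewrite add0r.
Qed.

HB.instance Definition _ :=
  Monoid.isComLaw.Build (set R) [set 0] (@sumset R) sumsetA sumsetC sum0set.

End SumsetMonoid.

(* Main.v *)
Require Import Defs.
From Corelib Require Import BinNums.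
From mathcomp Require Import all_boot all_order all_algebra.
From mathcomp Require Import all_classical all_reals.
From mathcomp Require Import topology normedtype.
From mathcomp Require Import ring lra.

(** Fix [t] in the sum of the hulls and finitely many gaps. Give a gap [U] of
    the [k]-th Cantor set the weight [(x_k + 1) |U|] and remove the gaps in
    order of decreasing weight, keeping intervals [J_1, ..., J_n] whose sum
    contains [t] and which satisfy [|J_j| >= x_j / (x_j + 1) * w] for every
    weight [w] still to come. Before [U] is removed from [J_k], the lengths of
    the other intervals add up to at least
    [(1 - x_k / (x_k + 1)) (x_k + 1) |U| = |U|], so [t] stays in the sum when
    [J_k] is replaced by one of the two pieces of [J_k] minus [U]. The gaps
    bordering [J_k] are at least as long as [U], hence, whatever the order of
    removal in the given trees, the density ratio bounds the length of both
    pieces below by [x_k |U| = x_k / (x_k + 1) * (x_k + 1) |U|], and the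
    invariant is preserved. All gaps are avoided at once by compactness. *)

Import Order.TTheory GRing.Theory Num.Theory.
Import numFieldNormedType.Exports.

Local Open Scope classical_set_scope.
Local Open Scope ring_scope.

(** * The binary tree of bridges *)

Definition cgap {R : realType} (C : cantor_system R) (i : positive) : R * R :=
  gap C (cbridge C i).

Lemma cgap_in {R : realType} (C : cantor_system R) (i : positive) :
  [/\ (cbridge C i).1 < (cgap C i).1, (cgap C i).1 < (cgap C i).2
    & (cgap C i).2 < (cbridge C i).2].
Proof. exact: gap_in C i. Qed.

Inductive descendant (i : positive) : positive -> Prop :=
| descendant_refl : descendant i i
| descendant_xO j : descendant i j -> descendant i (xO j)
| descendant_xI j : descendant i j -> descendant i (xI j).

Lemma descendant_root i : descendant xH i.
Proof. by elim: i => [i ?|i ?|]; constructor. Qed.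

(** The constructors of [descendant] extend a path at its lower end; this inspects its first step
    below [i]. *)
Lemma descendant_cases i j : descendant i j ->
  [\/ j = i, descendant (xO i) j | descendant (xI i) j].
Proof.
elim=> [|{}j _ [->|h|h]|{}j _ [->|h|h]]; first exact: Or31.
- by apply: Or32; constructor.
- by apply: Or32; constructor.
- by apply: Or33; constructor.
- by apply: Or33; constructor.
- by apply: Or32; constructor.
- by apply: Or33; constructor.
Qed.

Lemma cbridge_descendant {R : realType} (C : cantor_system R) i j :
  descendant i j ->
  (cbridge C i).1 <= (cbridge C j).1 /\ (cbridge C j).2 <= (cbridge C i).2.
Proof.
by elim=> [//|{}j _ [? ?]|{}j _ [? ?]]; have := cgap_in C j;
  rewrite /cgap /cbridge /= => -[? ? ?]; split; lra.
Qed.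

(** Induction along the path to [i]: a child lies inside its parent, so it stays apart from [j] if
    the parent was; if [j] is below the parent, the first step towards [j] decides. *)
Lemma descendant_or_apart {R : realType} (C : cantor_system R) i j :
  [\/ descendant i j, descendant j i,
      (cbridge C i).2 <= (cbridge C j).1 | (cbridge C j).2 <= (cbridge C i).1].
Proof.
elim: i => [i|i|]; last by apply: Or41; exact: descendant_root.
- case=> [/descendant_cases[->|h|h]|h|h|h].
  + by apply: Or42; do 2 constructor.
  + apply: Or44; have [_] := cbridge_descendant C _ _ h.
    by have := cgap_in C i; rewrite /cgap /cbridge /= => -[? ? ?]; lra.
  + exact: Or41.
  + by apply: Or42; constructor.
  + by apply: Or43.
  + apply: Or44; have := cgap_in C i.
    by move: h; rewrite /cgap /cbridge /= => h [? ? ?]; lra.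
- case=> [/descendant_cases[->|h|h]|h|h|h].
  + by apply: Or42; do 2 constructor.
  + exact: Or41.
  + apply: Or43; have [+ _] := cbridge_descendant C _ _ h.
    by have := cgap_in C i; rewrite /cgap /cbridge /= => -[? ? ?]; lra.
  + by apply: Or42; constructor.
  + apply: Or43; have := cgap_in C i.
    by move: h; rewrite /cgap /cbridge /= => h [? ? ?]; lra.
  + exact: Or44.
Qed.

(** Of two nested bridges the inner one lies in a child of the outer one, hence beside its gap. In
    each of the four cases a whole child of one bridge separates the two gaps. *)
Lemma cgap_beside_cbridge {R : realType} (C : cantor_system R) i j :
  i = j \/
  [\/ (cbridge C i).2 <= (cgap C j).1, (cgap C j).2 <= (cbridge C i).1,
      (cbridge C j).2 <= (cgap C i).1 | (cgap C i).2 <= (cbridge C j).1].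
Proof.
have [ai _ bi] := cgap_in C i; have [aj _ bj] := cgap_in C j.
case: (descendant_or_apart C i j) => [h|h|h|h].
- case: (descendant_cases _ _ h) => [->|k|k]; first by left.
  + by right; apply: Or43; case: (cbridge_descendant C _ _ k).
  + by right; apply: Or44; case: (cbridge_descendant C _ _ k).
- case: (descendant_cases _ _ h) => [->|k|k]; first by left.
  + by right; apply: Or41; case: (cbridge_descendant C _ _ k).
  + by right; apply: Or42; case: (cbridge_descendant C _ _ k).
- by right; apply: Or41; lra.
- by right; apply: Or43; lra.
Qed.

Lemma cgap_disjoint {R : realType} (C : cantor_system R) i j :
  [\/ i = j, (cgap C i).2 <= (cgap C j).1 | (cgap C j).2 <= (cgap C i).1].
Proof.
have [? ? ?] := cgap_in C i; have [? ? ?] := cgap_in C j.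
case: (cgap_beside_cbridge C i j) => [->|[]h]; first exact: Or31.
- by apply: Or32; lra.
- by apply: Or33; lra.
- by apply: Or33; lra.
- by apply: Or32; lra.
Qed.

Lemma cgap_in_hull {R : realType} (C : cantor_system R) i :
  (hull C).1 <= (cgap C i).1 /\ (cgap C i).2 <= (hull C).2.
Proof.
have [? ? ?] := cgap_in C i.
have := cbridge_descendant C _ _ (descendant_root i).
by rewrite {1 4}/cbridge /= => -[? ?]; split; lra.
Qed.

(** * Distances between gaps *)

(** The two differences are the lengths of the children of [cbridge C i]. *)
Definition thick {R : realType} (C : cantor_system R) (x : R) : Prop :=
  forall i, x * ilen (cgap C i) <= (cgap C i).1 - (cbridge C i).1 /\
            x * ilen (cgap C i) <= (cbridge C i).2 - (cgap C i).2.

Lemma thick_density_ratio {R : realType} (C : cantor_system R) (x : R) :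
  x <= density_ratio C -> thick C x.
Proof.
move=> xdr i; have [ai ui bi] := cgap_in C i.
suff: x <= Num.min ((cgap C i).1 - (cbridge C i).1)
                   ((cbridge C i).2 - (cgap C i).2) / ilen (cgap C i).
  rewrite ler_pdivlMr ?subr_gt0 // le_min => /andP[h1 h2]; by split.
apply: (le_trans xdr); apply: ge_inf; last by exists i.
(* [ge_inf] needs a lower bound, and all the ratios are nonnegative. *)
exists 0 => _ [j _ <-]; have [aj uj bj] := cgap_in C j.
rewrite divr_ge0 ?le_min /ilen /cbridge /=; move: aj uj bj;
  rewrite /cgap /cbridge; lra.
Qed.

(** Between the two gaps lies the left child of [i] or the right child of [j]; the latter is long
    enough because the gap of [j] is at least as long as that of [i]. *)
Lemma thick_left_of_cgap {R : realType} (C : cantor_system R) (x : R) i j :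
  0 <= x -> thick C x -> ilen (cgap C i) <= ilen (cgap C j) ->
  (cgap C j).2 <= (cgap C i).1 ->
  x * ilen (cgap C i) <= (cgap C i).1 - (cgap C j).2.
Proof.
move=> x0 th lij ji; have [? ? ?] := cgap_in C i; have [? ? ?] := cgap_in C j.
have [? _] := th i; have [_ ?] := th j.
have := ler_wpM2l x0 lij.
by case: (cgap_beside_cbridge C i j) => [ij|[]?]; [subst j; lra|lra..].
Qed.

Lemma thick_right_of_cgap {R : realType} (C : cantor_system R) (x : R) i j :
  0 <= x -> thick C x -> ilen (cgap C i) <= ilen (cgap C j) ->
  (cgap C i).2 <= (cgap C j).1 ->
  x * ilen (cgap C i) <= (cgap C j).1 - (cgap C i).2.
Proof.
move=> x0 th lij ji; have [? ? ?] := cgap_in C i; have [? ? ?] := cgap_in C j.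
have [_ ?] := th i; have [? _] := th j.
have := ler_wpM2l x0 lij.
by case: (cgap_beside_cbridge C i j) => [ij|[]?]; [subst j; lra|lra..].
Qed.

Lemma thick_from_hull {R : realType} (C : cantor_system R) (x : R) i :
  thick C x ->
  x * ilen (cgap C i) <= (cgap C i).1 - (hull C).1 /\
  x * ilen (cgap C i) <= (hull C).2 - (cgap C i).2.
Proof.
move=> th; have [? ?] := th i.
have := cbridge_descendant C _ _ (descendant_root i).
by rewrite {1 4}/cbridge /= => -[? ?]; split; lra.
Qed.

(** * Removing finitely many gaps *)

Definition update {I : eqType} {T : Type} (k : I) (y : T) (f : I -> T) (j : I) : T :=
  if j == k then y else f j.

Lemma sum_update {R : realType} {n : nat} (k : 'I_n) (y : R) (f : 'I_n -> R) :
  \sum_j update k y f j = \sum_j f j - f k + y.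
Proof.
rewrite (bigD1 k) //= [in RHS](bigD1 k) //= /update eqxx.
have -> : \sum_(j | j != k) (if j == k then y else f j) = \sum_(j | j != k) f j.
  by apply: eq_bigr => j /negPf ->.
lra.
Qed.

(** Each [c j] divides [[a j, b j]] in the ratio in which [t] divides the interval between the two
    sums; if that is a point, [c = a]. *)
Lemma sum_between {R : realType} {n : nat} (a b : 'I_n -> R) (t : R) :
  (forall j, a j <= b j) -> \sum_j a j <= t <= \sum_j b j ->
  exists c : 'I_n -> R, (forall j, a j <= c j <= b j) /\ \sum_j c j = t.
Proof.
move=> ab /andP[at_ tb].
have [e|ne] := eqVneq (\sum_j a j) (\sum_j b j).
  by exists a; split=> [j|]; [rewrite lexx ab | lra].
have d0 : 0 < \sum_j b j - \sum_j a j.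
  by rewrite subr_gt0 lt_neqAle ne (le_trans at_).
pose l := (t - \sum_j a j) / (\sum_j b j - \sum_j a j).
have l0 : 0 <= l by rewrite divr_ge0 // ?(ltW d0) // subr_ge0.
have l1 : l <= 1 by rewrite /l ler_pdivrMr // mul1r lerD2r.
exists (fun j => a j + l * (b j - a j)); split=> [j|].
  by have := ab j; move=> ?; apply/andP; split; nra.
rewrite big_split /= -mulr_sumr sumrB divfK ?gt_eqF //; ring.
Qed.

(* Both 0 and 1 are sent to the root.                                        *)
Definition pos_enum (m : nat) : positive :=
  if bin_of_nat m is Npos p then p else xH.

Lemma pos_enum_surj (i : positive) : exists m, pos_enum m = i.
Proof. by exists (nat_of_bin (Npos i)); rewrite /pos_enum nat_of_binK. Qed.

(** Natural numbers as indices make every gap appear in some initial segment [iota 0 m], as the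
    limit argument requires. *)
Definition egap {R : realType} {n : nat} (C : 'I_n -> cantor_system R)
  (p : 'I_n * nat) : R * R := cgap (C p.1) (pos_enum p.2).

Definition weight {R : realType} {n : nat} (C : 'I_n -> cantor_system R)
  (x : 'I_n -> R) (p : 'I_n * nat) : R := (x p.1 + 1) * ilen (egap C p).

(* The remaining gaps [s] weigh no more than the gap bordering [y]; this is   *)
(* what makes the bridges of the next gap to be removed long enough.         *)
Definition left_end {R : realType} {n : nat} (C : 'I_n -> cantor_system R)
    (x : 'I_n -> R) (s : seq ('I_n * nat)) (k : 'I_n) (y : R) : Prop :=
  y = (hull (C k)).1 \/ exists m, y = (egap C (k, m)).2 /\
    {in s, forall q, weight C x q <= weight C x (k, m)}.

Definition right_end {R : realType} {n : nat} (C : 'I_n -> cantor_system R)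
    (x : 'I_n -> R) (s : seq ('I_n * nat)) (k : 'I_n) (y : R) : Prop :=
  y = (hull (C k)).2 \/ exists m, y = (egap C (k, m)).1 /\
    {in s, forall q, weight C x q <= weight C x (k, m)}.

(** Within one Cantor set weights compare as lengths do, so [thick_left_of_cgap] applies. The first
    alternative includes a gap that is listed twice and already borders [y]. *)
Lemma left_end_far {R : realType} {n : nat} (C : 'I_n -> cantor_system R)
    (x : 'I_n -> R) s k m y : 0 <= x k -> thick (C k) (x k) ->
  (k, m) \in s -> left_end C x s k y ->
  (egap C (k, m)).2 <= y \/
  x k * ilen (egap C (k, m)) <= (egap C (k, m)).1 - y.
Proof.
move=> xk th ms [->|[i [-> /(_ _ ms) w]]].
  by right; case: (thick_from_hull _ _ (pos_enum m) th).
have /= l : ilen (egap C (k, m)) <= ilen (egap C (k, i)).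
  by move: w; rewrite /weight /= ler_pM2l //; lra.
have [? ? ?] := cgap_in (C k) (pos_enum i).
case: (cgap_disjoint (C k) (pos_enum m) (pos_enum i)) => [e|h|h].
- by left; rewrite /egap /= e.
- by left; rewrite /egap /=; lra.
- by right; apply: thick_left_of_cgap.
Qed.

Lemma right_end_far {R : realType} {n : nat} (C : 'I_n -> cantor_system R)
    (x : 'I_n -> R) s k m y : 0 <= x k -> thick (C k) (x k) ->
  (k, m) \in s -> right_end C x s k y ->
  y <= (egap C (k, m)).1 \/
  x k * ilen (egap C (k, m)) <= y - (egap C (k, m)).2.
Proof.
move=> xk th ms [->|[i [-> /(_ _ ms) w]]].
  by right; case: (thick_from_hull _ _ (pos_enum m) th).
have /= l : ilen (egap C (k, m)) <= ilen (egap C (k, i)).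
  by move: w; rewrite /weight /= ler_pM2l //; lra.
have [? ? ?] := cgap_in (C k) (pos_enum i).
case: (cgap_disjoint (C k) (pos_enum m) (pos_enum i)) => [e|h|h].
- by left; rewrite /egap /= e.
- by right; apply: thick_right_of_cgap.
- by left; rewrite /egap /=; lra.
Qed.

(** Induction on [s] for arbitrary [a] and [b]. The intervals cut so far need not be bridges; what
    is retained about their ends is which gap borders them. *)
Lemma avoid_sorted_gaps {R : realType} {n : nat} (C : 'I_n -> cantor_system R)
    (x : 'I_n -> R) (t : R) (s : seq ('I_n * nat)) (a b : 'I_n -> R) :
  (forall k, 0 <= x k) -> (forall k, thick (C k) (x k)) ->
  1 <= \sum_k x k / (x k + 1) ->
  pairwise (fun p q => weight C x q <= weight C x p) s ->
  (forall k, left_end C x s k (a k)) -> (forall k, right_end C x s k (b k)) ->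
  (forall k, a k <= b k) ->
  (forall k, {in s, forall p, x k / (x k + 1) * weight C x p <= b k - a k}) ->
  \sum_k a k <= t <= \sum_k b k ->
  exists c : 'I_n -> R,
    [/\ forall k, a k <= c k <= b k, \sum_k c k = t &
        {in s, forall p, ~ oitv (egap C p) (c p.1)}].
Proof.
move=> x0 th sum1; elim: s a b => [|[k m] s IH] a b.
  move=> _ _ _ ab _ /(sum_between _ _ _ ab)[c [abc ct]].
  by exists c; split.
move=> /= /andP[/allP wmax srt] aend bend ab len att.
have inS q : q \in s -> q \in (k, m) :: s by rewrite in_cons => ->; rewrite orbT.
have kmS : (k, m) \in (k, m) :: s by rewrite in_cons eqxx.
have aend' j : left_end C x s j (a j).
  by case: (aend j) => [->|[i [-> w]]]; [left | right; exists i; split=> // q /inS/w].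
have bend' j : right_end C x s j (b j).
  by case: (bend j) => [->|[i [-> w]]]; [left | right; exists i; split=> // q /inS/w].
have xk1 : 0 < x k + 1 by have := x0 k; lra.
have [_ uv _] := cgap_in (C k) (pos_enum m).
rewrite -/(egap C (k, m)) in uv.
suff [a' [b' [aa' [bb' [aend2 [bend2 [ab2 [len2 [att2 miss]]]]]]]]] :
  exists a' b' : 'I_n -> R, (forall j, a j <= a' j) /\ (forall j, b' j <= b j) /\
    (forall j, left_end C x s j (a' j)) /\ (forall j, right_end C x s j (b' j)) /\
    (forall j, a' j <= b' j) /\
    (forall j, {in s, forall p, x j / (x j + 1) * weight C x p <= b' j - a' j}) /\
    \sum_j a' j <= t <= \sum_j b' j /\
    (b' k <= (egap C (k, m)).1 \/ (egap C (k, m)).2 <= a' k).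
  have [c [abc ct cs]] := IH a' b' srt aend2 bend2 ab2 len2 att2.
  exists c; split=> // [j|p].
    by have := abc j; have := aa' j; have := bb' j => ? ? /andP[? ?]; lra.
  rewrite in_cons => /predU1P[->|/cs//] /=.
  by rewrite /oitv /= in_itv /= => /andP[? ?]; have /andP[? ?] := abc k; lra.
have len' j : {in s, forall p, x j / (x j + 1) * weight C x p <= b j - a j}.
  by move=> p /inS/len.
(* A gap beside the current interval is avoided without any cut. *)
have [va|Lk] := left_end_far _ _ _ _ _ _ (x0 k) (th k) kmS (aend k).
  by exists a, b; do !split=> //; right.
have [bu|Rk] := right_end_far _ _ _ _ _ _ (x0 k) (th k) kmS (bend k).
  by exists a, b; do !split=> //; left.
set u := (egap C (k, m)).1 in uv Lk Rk *.
set v := (egap C (k, m)).2 in uv Lk Rk *.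
have uvE : ilen (egap C (k, m)) = v - u by [].
rewrite uvE in Lk Rk.
have xuv : 0 <= x k * (v - u) by rewrite mulr_ge0 // subr_ge0 ltW.
(* Since [v - u] is at most the total length of the other intervals, the two  *)
(* sums obtained from the left and the right bridge leave no hole.           *)
have others : v - u <= \sum_j (b j - a j) - (b k - a k).
  have : (\sum_(j | j != k) x j / (x j + 1)) * weight C x (k, m)
         <= \sum_(j | j != k) (b j - a j).
    by rewrite mulr_suml; apply: ler_sum => j _; exact: len.
  rewrite [\sum_j (b j - a j)](bigD1 k) //= addrC addrK; apply: le_trans.
  rewrite /weight uvE /= mulrA ler_peMl ?subr_ge0 ?(ltW uv) //.
  move: sum1; rewrite (bigD1 k) //= => sum1.
  have e : x k / (x k + 1) * (x k + 1) = x k by rewrite divfK // gt_eqF.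
  have := ler_wpM2r (ltW xk1) sum1; rewrite mulrDl e; lra.
(* By [Lk] and [Rk], either piece is then long enough for every later weight. *)
have wk q : q \in s -> x k / (x k + 1) * weight C x q <= x k * (v - u).
  move=> /wmax /= w; apply: (@le_trans _ _ (x k / (x k + 1) * weight C x (k, m))).
    by rewrite ler_wpM2l // divr_ge0 // ltW.
  by rewrite /weight uvE /= mulrA divfK ?gt_eqF.
rewrite sumrB in others; case/andP: att => at_ tb.
(* The bound is the largest sum attainable with the left piece. A larger [t] exceeds, by [others],
   the smallest sum attainable with the right piece. *)
have [tL|tR] := lerP t (\sum_j b j - b k + u).
- exists a, (update k u b); rewrite !sum_update; do !split=> //.
  + by move=> j; rewrite /update; case: eqP => [->|_]; lra.
  + move=> j; rewrite /update; case: eqP => [->|_] //.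
    by right; exists m; split.
  + by move=> j; rewrite /update; case: eqP => [->|_] //; lra.
  + move=> j q qs; rewrite /update; case: eqP => [->|_]; last exact: len'.
    by have := wk q qs; lra.
  + by rewrite at_.
  + by left; rewrite /update eqxx.
- exists (update k v a), b; rewrite !sum_update; do !split=> //.
  + by move=> j; rewrite /update; case: eqP => [->|_]; lra.
  + move=> j; rewrite /update; case: eqP => [->|_] //.
    by right; exists m; split.
  + by move=> j; rewrite /update; case: eqP => [->|_] //; lra.
  + move=> j q qs; rewrite /update; case: eqP => [->|_]; last exact: len'.
    by have := wk q qs; lra.
  + by rewrite tb andbT; lra.
  + by right; rewrite /update eqxx.
Qed.

Lemma avoid_gaps {R : realType} {n : nat} (C : 'I_n -> cantor_system R)
    (x : 'I_n -> R) (t : R) (s : seq ('I_n * nat)) :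
  (forall k, 0 <= x k) -> (forall k, thick (C k) (x k)) ->
  1 <= \sum_k x k / (x k + 1) ->
  (forall j k, x j / (x j + 1) * (x k + 1) * ilen (hull (C k))
               <= ilen (hull (C j))) ->
  \sum_k (hull (C k)).1 <= t <= \sum_k (hull (C k)).2 ->
  exists c : 'I_n -> R,
    [/\ forall k, citv (hull (C k)) (c k), \sum_k c k = t &
        {in s, forall p, ~ oitv (egap C p) (c p.1)}].
Proof.
move=> x0 th sum1 len ht.
pose r p q := weight C x q <= weight C x p.
have r_total : total r by move=> p q; exact: le_total.
have r_trans : transitive r by move=> p q z qp zq; exact: le_trans qp.
have srt : pairwise r (sort r s) by rewrite -sorted_pairwise // sort_sorted.
have [||||c [hc ct cs]] := avoid_sorted_gaps C x t (sort r s)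
  (fun k => (hull (C k)).1) (fun k => (hull (C k)).2) x0 th sum1 srt _ _ _ _ ht.
- by move=> k; left.
- by move=> k; left.
- by move=> k; exact/ltW/hull_lt.
(* A gap is no longer than its hull, so the hypothesis on the hulls bounds every weight. *)
- move=> j [k m] _; apply: le_trans (len j k); rewrite /weight /= mulrA.
  rewrite ler_wpM2l ?mulr_ge0 ?invr_ge0 ?addr_ge0 //.
  have [? ?] := cgap_in_hull (C k) (pos_enum m).
  by rewrite /ilen /egap /=; lra.
- by exists c; split=> // p ps; apply: cs; rewrite mem_sort.
Qed.

(** * Passing to the limit *)

(** If a finer proper filter had a set outside [f @ F], the complement of that set would be in
    [f @ F], hence in the finer filter as well. *)
Lemma ultra_fmap {T U : Type} (f : T -> U) (F : set_system T) :
  UltraFilter F -> UltraFilter (f @ F).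
Proof.
move=> FU; split; first exact: fmap_proper_filter.
move=> G GP FG; apply/seteqP; split=> // A GA.
have [//|FA] := in_ultra_setVsetC (f @^-1` A) FU.
have : G (~` A) by apply: FG.
by move=> /(filterI GA); rewrite setICr => /filter_not_empty.
Qed.

Lemma avoid_all_gaps {R : realType} {n : nat} (C : 'I_n -> cantor_system R)
    (t : R) :
  (forall s : seq ('I_n * nat), exists c : 'I_n -> R,
    [/\ forall k, citv (hull (C k)) (c k), \sum_k c k = t &
        {in s, forall p, ~ oitv (egap C p) (c p.1)}]) ->
  exists c : 'I_n -> R, (forall k, cantor_set (C k) (c k)) /\ \sum_k c k = t.
Proof.
(* The point [c m] avoids the gaps numbered below [m] in every Cantor set. *)
move=> /(_ [seq (k, p) | k <- enum 'I_n, p <- iota 0 _]) fin.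
have [c cP] := choice fin.
(* Along one ultrafilter all coordinates converge at once, by compactness of the hulls; the limit
   avoids each gap because its complement is closed. *)
have [F [FU ooF]] := ultraFilterLemma (F := \oo) _.
have lim k : exists l, citv (hull (C k)) l /\ c m k @[m --> F] --> l.
  have := @segment_compact R (hull (C k)).1 (hull (C k)).2.
  rewrite compact_ultra /= => /(_ _ (ultra_fmap (c ^~ k) F FU)) [|l [? ?]].
    by apply: (@filterE _ F) => m /=; case: (cP m) => /(_ k).
  by exists l.
have [l lP] := choice lim.
exists l; split=> [k|].
- split; first by case: (lP k).
  move=> [i _]; have [m0 <-] := pos_enum_surj i.
  rewrite -/(cgap _ _) -/(egap C (k, m0)).
  apply: (@closed_cvg _ _ F _ (c ^~ k) (~` oitv (egap C (k, m0)))); last by case: (lP k).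
    by apply: open_closedC; exact: itv_open.
  apply: ooF; near=> m; have [_ _] := cP m => /(_ (k, m0)); apply.
  apply/allpairsP; exists (k, m0); split=> //=; rewrite ?mem_enum // mem_iota /=.
  by near: m; exact: nbhs_infty_gt.
- have cv : \sum_k c m k @[m --> F] --> \sum_k l k.
    by apply: cvg_big => [|k _]; [exact: add_continuous | case: (lP k)].
  apply: (cvg_unique (@norm_hausdorff _ R) cv).
  have -> : (fun m => \sum_k c m k) = fun=> t.
    by apply/funext => m; case: (cP m).
  exact: cvg_cst.
Unshelve. all: by end_near.
Qed.

(** * Sumsets *)

(** Turns both sides of the theorem into statements about families of summands. *)
Lemma big_sumsetP {R : realType} {n : nat} (A : 'I_n -> set R) (z : R) :
  (\big[@sumset R/[set 0]]_(i < n) A i) z <->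
  exists c : 'I_n -> R, (forall i, A i (c i)) /\ \sum_i c i = z.
Proof.
split=> [|[c [Ac <-]]]; last first.
  elim/big_rec2 : _ => [//|i y S _ Sy].
  by exists (c i) => //; exists y.
elim: n A z => [|n IH] A z.
  rewrite big_ord0 => ->; exists (fun=> 0); split=> [[]//|].
  by rewrite big_ord0.
rewrite big_ord_recl => -[y Ay [_ /IH [c [Ac <-]] <-]].
exists (fun i => if unlift ord0 i is Some j then c j else y); split=> [i|].
  by case: unliftP => [j ->|->].
rewrite big_ord_recl unlift_none; congr (_ + _).
by apply: eq_bigr => j _; rewrite liftK.
Qed.

Theorem theorem3p2 (R : realType) (n : nat) (n_ge2 : (2 <= n)%N)
    (C : 'I_n -> cantor_system R) (x : 'I_n -> R)
    (x_ge0 : forall i, 0 <= x i)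
    (dr_ge : forall i, density_ratio (C i) >= x i)
    (sum_ge1 : \sum_(i < n) x i / (x i + 1) >= 1)
    (len_ge : forall j k, ilen (hull (C j)) >=
       x j / (x j + 1) * (x k + 1) * ilen (hull (C k))) :
  \big[@sumset R/[set 0]]_(i < n) cantor_set (C i) =
  \big[@sumset R/[set 0]]_(i < n) citv (hull (C i)).
Proof.
apply/seteqP; split=> t /big_sumsetP[c [cC ct]]; apply/big_sumsetP.
  by exists c; split=> // i; case: (cC i).
apply: avoid_all_gaps => s; apply: avoid_gaps x_ge0 _ sum_ge1 len_ge _.
  by move=> k; exact: thick_density_ratio.
rewrite -ct; apply/andP; split; apply: ler_sum => k _;
  by have := cC k; rewrite /citv /= in_itv /= => /andP[].
Qed.
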